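(* Let $L$ be a nonempty set equipped with a metric $d_L\colon L\times L\to[0,1]$, let $\mathcal{M}=(S,A,\tau,\rho,\ell)$ be an $L$-labelled continuous-time Markov chain, and let $\lambda\in(0,1)$. Then the least fixed point $\delta_\lambda$ of $\Delta_\lambda$ is the unique fixed point of $\Delta_\lambda$. Moreover, for every $n\in\mathbb{N}$ and every $d\colon S\times S\to[0,1]$, $\|\delta_\lambda-\Delta_\lambda^n(d)\|\le\frac{\lambda^n}{1-\lambda}\|\Delta_\lambda(d)-d\|$, where $\|f-g\|=\sup_{s,t\in S}|f(s,t)-g(s,t)|$.
   Context: An $L$-labelled CTMC is a tuple $\mathcal{M}=(S,A,\tau,\rho,\ell)$: $S$ nonempty finite set of states, $A\subseteq S$ absorbing states, $\tau\colon S\setminus A\to\mathcal{D}(S)$ transition probability function (probability distributions on $S$), $\rho\colon S\setminus A\to\mathbb{R}_{>0}$ exit rates, $\ell\colon S\to L$ labelling. $s\equiv_A t$ means $s,t\in A$ or $s,t\notin A$. $\mathsf{exp}[r]$ is the exponential distribution of rate $r$ on $\mathbb{R}$; $\|\mu-\nu\|_{TV}=\sup_E|\mu(E)-\nu(E)|$ over Borel sets. $\Omega(\mu,\nu)$ is the set of couplings (joint distributions on $S\times S$ with marginals $\mu,\nu$); $\mathcal{K}_d(\mu,\nu)=\min_{\omega\in\Omega(\mu,\nu)}\sum_{u,v}d(u,v)\omega(u,v)$. With $\alpha(s,t)=\|\mathsf{exp}[\rho(s)]-\mathsf{exp}[\rho(t)]\|_{TV}$, $\beta(s,t)=d_L(\ell(s),\ell(t))$,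 $\mathcal{T}(d)(s,t)=\alpha(s,t)+(1-\alpha(s,t))\mathcal{K}_d(\tau(s),\tau(t))$, the operator $\Delta_\lambda$ on $[0,1]^{S\times S}$ is $\Delta_\lambda(d)(s,t)=1$ if $s\not\equiv_A t$; $\beta(s,t)$ if $s,t\in A$; $\max\{\beta(s,t),\lambda\mathcal{T}(d)(s,t)\}$ if $s,t\notin A$. $[0,1]^{S\times S}$ is ordered pointwise (a complete lattice), $\Delta_\lambda$ is monotone, and $\delta_\lambda$ denotes its least fixed point (the $\lambda$-discounted bisimilarity distance). *)

(* Defs.v *)
From HB Require Import structures.
From mathcomp Require Import all_boot all_order all_algebra.
From mathcomp Require Import all_classical all_reals all_analysis.

Set Implicit Arguments.
Unset Strict Implicit.
Unset Printing Implicit Defensive.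

Import Order.TTheory GRing.Theory Num.Theory.
Import numFieldNormedType.Exports.

Local Open Scope classical_set_scope.
Local Open Scope ring_scope.

Record fdist (R : realType) (S : finType) := FDist {
  fdist_fun :> S -> R ;
  fdist_ge0 : forall s, 0 <= fdist_fun s ;
  fdist_sum1 : \sum_(s : S) fdist_fun s = 1 }.

Record ctmc (R : realType) (L : Type) := CTMC {
  state : finType ;
  state_nonempty : (0 < #|state|)%N ;
  absorbing : {set state} ;
  trans : {s : state | s \notin absorbing} -> fdist R state ;
  rate : {s : state | s \notin absorbing} -> R ;
  rate_gt0 : forall s, 0 < rate s ;
  label : state -> L }.

Arguments absorbing {R L} _.
Arguments trans {R L} _ _.
Arguments rate {R L} _ _.
Arguments label {R L} _ _.

(* For finite measures only, as [fine] sends infinite values to 0. *)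
Definition tv_dist (R : realType) (d : measure_display) (T : measurableType d)
    (mu nu : set T -> \bar R) : R :=
  sup [set `|fine (mu E) - fine (nu E)| | E in [set E | measurable E]].

Definition coupling (R : realType) (S : finType) (mu nu : fdist R S) :
    set (fdist R (S * S)%type) :=
  [set w | (forall u, \sum_(v : S) w (u, v) = mu u) /\
           (forall v, \sum_(u : S) w (u, v) = nu v)].

(* The set of couplings is a nonempty compact polytope and the cost is linear,
   so this infimum is a minimum. *)
Definition kantorovich (R : realType) (S : finType) (d : S -> S -> R)
    (mu nu : fdist R S) : R :=
  inf [set \sum_(u : S) \sum_(v : S) d u v * w (u, v) | w in coupling mu nu].

Definition unit_valued (R : realType) (S : Type) (d : S -> S -> R) : Prop :=
  forall s t, 0 <= d s t <= 1.

Definition sup_dist (R : realType) (S : Type) (f g : S -> S -> R) : R :=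
  sup [set `|f p.1 p.2 - g p.1 p.2| | p in [set: S * S]].

Section BisimilarityDistance.
Context {R : realType} {L : metricType R} (M : ctmc R L).

Notation S := (state M).
Notation nonabs := {s : S | s \notin absorbing M}.

Definition alpha (s t : nonabs) : R :=
  tv_dist (exponential_prob (rate M s) : set (measurableTypeR R) -> \bar R)
          (exponential_prob (rate M t)).

Definition beta (s t : S) : R := mdist (label M s) (label M t).

Definition calT (d : S -> S -> R) (s t : nonabs) : R :=
  alpha s t + (1 - alpha s t) * kantorovich d (trans M s) (trans M t).

(* [insub s] is [Some s'] with [val s' = s] when [s] is not absorbing, and
   [None] when it is. *)
Definition Delta (lambda : R) (d : S -> S -> R) (s t : S) : R :=
  match insub s : option nonabs, insub t : option nonabs with
  | Some s', Some t' => Num.max (beta s t) (lambda * calT d s' t')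
  | None, None => beta s t
  | _, _ => 1
  end.

Definition fixpoint (lambda : R) : set (S -> S -> R) :=
  [set d | unit_valued d /\ Delta lambda d = d].

Definition least_fixpoint (lambda : R) : set (S -> S -> R) :=
  [set d | fixpoint lambda d /\
           forall d', fixpoint lambda d' -> forall s t, d s t <= d' s t].

(* There is at most one least fixed point; the default value 0 would only be
   returned if there were none. *)
Definition delta (lambda : R) : S -> S -> R :=
  xget (fun _ _ => 0) (least_fixpoint lambda).

End BisimilarityDistance.

Arguments alpha {R L} M s t.
Arguments beta {R L} M s t.
Arguments calT {R L} M d s t.
Arguments Delta {R L} M lambda d s t.
Arguments fixpoint {R L} M lambda _.
Arguments least_fixpoint {R L} M lambda _.
Arguments delta {R L} M lambda _ _.

(* Main.v *)
(* [Delta] is monotone and, since the Kantorovich distance is 1-Lipschitz in its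
   cost and [1 - alpha] lies in [0, 1], it is a [lambda]-contraction for the sup
   distance.  Both facts are the single statement that [d <= d' + c] implies
   [Delta d <= Delta d' + lambda c].  Monotonicity gives the least fixed point
   (Knaster-Tarski), so completeness of the function space is never needed;
   contraction gives its uniqueness and the error bound. *)

Require Import Defs.
From HB Require Import structures.
From mathcomp Require Import all_boot all_order all_algebra.
From mathcomp Require Import all_classical all_reals all_analysis.
From mathcomp Require Import measurable_realfun lra.
Set Implicit Arguments.
Unset Strict Implicit.
Unset Printing Implicit Defensive.
Import Order.TTheory GRing.Theory Num.Theory.
Import numFieldNormedType.Exports.
Local Open Scope classical_set_scope.
Local Open Scope ring_scope.

(** * Total variation between exponential laws *)

Lemma fine_exponential_prob_itv (R : realType) (r : R)
    (E : set (measurableTypeR R)) :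
  0 < r -> measurable E -> 0 <= fine (exponential_prob r E) <= 1.
Proof.
move=> r0 mE.
have pdf_ge0 x : (0 <= (exponential_pdf r x)%:E)%E.
  by rewrite lee_fin exponential_pdf_ge0// ltW.
have p0 : (0 <= exponential_prob r E)%E by exact: integral_ge0.
have p1 : (exponential_prob r E <= 1)%E.
  (* With 1 written as the integral of the density over the whole line, the bound is monotonicity of
     the integral in its domain. *)
  rewrite -(integral_exponential_pdf r0) /exponential_prob.
  apply: ge0_subset_integral => //.
  by apply/measurable_EFinP; exact: measurable_exponential_pdf.
rewrite fine_ge0//= -lee_fin fineK// ge0_fin_numE//.
exact: le_lt_trans p1 (ltry _).
Qed.

Lemma alpha_itv (R : realType) (L : metricType R) (M : ctmc R L)
    (s t : {s : state M | s \notin absorbing M}) : 0 <= alpha M s t <= 1.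
Proof.
rewrite /alpha /tv_dist; set V := [set _ | _ in _].
have ubV : ubound V 1.
  move=> _ [E mE <-].
  have /andP[? ?] := fine_exponential_prob_itv (rate_gt0 s) mE.
  have /andP[? ?] := fine_exponential_prob_itv (rate_gt0 t) mE.
  by rewrite ler_norml; apply/andP; split; lra.
(* The empty event shows that [V] is nonempty, and its value, an absolute value, lies between 0 and
   the supremum. *)
have V0 : V `|fine (exponential_prob (rate M s) set0) -
               fine (exponential_prob (rate M t) set0)|.
  by exists set0 => //; exact: measurable0.
apply/andP; split; last by apply: ge_sup => //; eexists; exact: V0.
by apply: le_trans (ub_le_sup _ V0) => //; exists 1.
Qed.

(** * Couplings and the Kantorovich distance *)

Lemma coupling_sum1 (R : realType) (S : finType) (mu nu : fdist R S)
    (w : fdist R (S * S)%type) :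
  coupling mu nu w -> \sum_u \sum_v w (u, v) = 1.
Proof. by case=> wmu _; rewrite (eq_bigr mu) ?fdist_sum1. Qed.

(** The product distribution is a coupling. This makes the infimum in [kantorovich] range over a
    nonempty set. *)
Lemma coupling_nonempty (R : realType) (S : finType) (mu nu : fdist R S) :
  coupling mu nu !=set0.
Proof.
pose w (p : S * S) := mu p.1 * nu p.2.
have w_ge0 p : 0 <= w p by rewrite mulr_ge0 ?fdist_ge0.
have w_mu u : \sum_v w (u, v) = mu u by rewrite /w/= -mulr_sumr fdist_sum1 mulr1.
have w_nu v : \sum_u w (u, v) = nu v by rewrite /w/= -mulr_suml fdist_sum1 mul1r.
have w_sum1 : \sum_p w p = 1.
  rewrite -(fdist_sum1 mu) -(eq_bigr _ (fun u _ => w_mu u)) pair_bigA/=.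
  by apply: eq_bigr => -[].
by exists (FDist w_ge0 w_sum1).
Qed.

Section Kantorovich.
Context {R : realType} {S : finType} (mu nu : fdist R S).

Let cost (d : S -> S -> R) (w : fdist R (S * S)%type) :=
  \sum_u \sum_v d u v * w (u, v).

Lemma transport_cost_ge0 (d : S -> S -> R) w :
  (forall u v, 0 <= d u v) -> 0 <= cost d w.
Proof.
by move=> d0; do 2!apply: sumr_ge0 => ? _; rewrite mulr_ge0 ?fdist_ge0.
Qed.

(** A coupling has total mass 1, so raising the cost function by the constant [c] raises the
    transport cost by exactly [c]. *)
Lemma transport_cost_le_add (d d' : S -> S -> R) (c : R) w :
  coupling mu nu w -> (forall u v, d u v <= d' u v + c) ->
  cost d w <= cost d' w + c.
Proof.
move=> wP dd'; rewrite -[c in leRHS]mulr1.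
rewrite -(coupling_sum1 wP) mulr_sumr -big_split/=.
apply: ler_sum => u _; rewrite mulr_sumr -big_split/=.
by apply: ler_sum => v _; rewrite -mulrDl ler_wpM2r ?fdist_ge0.
Qed.

Lemma kantorovich_ge0 (d : S -> S -> R) :
  (forall u v, 0 <= d u v) -> 0 <= kantorovich d mu nu.
Proof.
move=> d0; apply: lb_le_inf.
  by have [w wP] := coupling_nonempty mu nu; exists (cost d w), w.
by move=> _ [w _ <-]; exact: transport_cost_ge0.
Qed.

Lemma kantorovich_le_cost (d : S -> S -> R) w :
  (forall u v, 0 <= d u v) -> coupling mu nu w ->
  kantorovich d mu nu <= cost d w.
Proof.
move=> d0 wP; apply: ge_inf; last by exists w.
by exists 0 => _ [w' _ <-]; exact: transport_cost_ge0.
Qed.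

(** The set of couplings does not depend on the cost function, so the inequality holds coupling by
    coupling and passes to the infimum. Nonnegativity of [d] bounds its transport costs below. *)
Lemma kantorovich_le_add (d d' : S -> S -> R) (c : R) :
  (forall u v, 0 <= d u v) -> (forall u v, d u v <= d' u v + c) ->
  kantorovich d mu nu <= kantorovich d' mu nu + c.
Proof.
move=> d0 dd'; rewrite -lerBlDr; apply: lb_le_inf.
  by have [w wP] := coupling_nonempty mu nu; exists (cost d' w), w.
move=> _ [w wP <-]; rewrite lerBlDr.
exact: le_trans (kantorovich_le_cost d0 wP) (transport_cost_le_add wP dd').
Qed.

Lemma kantorovich_le1 (d : S -> S -> R) :
  unit_valued d -> kantorovich d mu nu <= 1.
Proof.
move=> dP; have d0 u v : 0 <= d u v by case/andP: (dP u v).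
have [w wP] := coupling_nonempty mu nu.
apply: le_trans (kantorovich_le_cost d0 wP) _.
(* The cost is compared with the zero function, with [c] equal to 1. *)
have d1 u v : d u v <= 0 + 1 by rewrite add0r; case/andP: (dP u v).
apply: le_trans (transport_cost_le_add (d' := fun _ _ => 0) wP d1) _.
rewrite /cost big1 ?add0r// => u _.
by rewrite big1// => v _; rewrite mul0r.
Qed.

End Kantorovich.

(** * The sup distance between unit-valued functions *)

Section SupDist.
Context {R : realType} {S : Type}.
Implicit Types f g h : S -> S -> R.

Lemma sup_dist_ub f g s t :
  unit_valued f -> unit_valued g -> `|f s t - g s t| <= sup_dist f g.
Proof.
move=> fP gP; apply: ub_le_sup; last by exists (s, t).
exists 1 => _ [[u v] _ <-] /=; have := fP u v; have := gP u v.
by move=> /andP[? ?] /andP[? ?]; rewrite ler_norml; apply/andP; split; lra.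
Qed.

(** Over an empty [S] the supremum is 0 while a negative [c] satisfies the bound vacuously; hence
    the nonemptiness. *)
Lemma sup_dist_le f g c : [set: S] !=set0 ->
  (forall s t, `|f s t - g s t| <= c) -> sup_dist f g <= c.
Proof.
move=> [s _] fg; apply: ge_sup; first by exists `|f s s - g s s|, (s, s).
by move=> _ [[u v] _ <-]; exact: fg.
Qed.

Lemma le_add_sup_dist f g s t : unit_valued f -> unit_valued g ->
  f s t <= g s t + sup_dist f g /\ g s t <= f s t + sup_dist f g.
Proof.
by move=> fP gP; have := sup_dist_ub s t fP gP;
  rewrite ler_norml => /andP[? ?]; split; lra.
Qed.

Lemma sup_dist_ge0 f g : [set: S] !=set0 ->
  unit_valued f -> unit_valued g -> 0 <= sup_dist f g.
Proof. by move=> [s _] fP gP; exact: le_trans (sup_dist_ub s s fP gP). Qed.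

Lemma sup_dist_triangle f g h : [set: S] !=set0 ->
  unit_valued f -> unit_valued g -> unit_valued h ->
  sup_dist f h <= sup_dist f g + sup_dist g h.
Proof.
move=> S0 fP gP hP; apply: sup_dist_le => // s t.
apply: le_trans (ler_distD (g s t) _ _) _.
by apply: lerD; exact: sup_dist_ub.
Qed.

Lemma sup_dist_le0_eq f g : unit_valued f -> unit_valued g ->
  sup_dist f g <= 0 -> f = g.
Proof.
move=> fP gP fg0; apply/funext => s; apply/funext => t; apply/eqP.
by rewrite -subr_eq0 -normr_le0 (le_trans (sup_dist_ub s t fP gP)).
Qed.

End SupDist.

(** * Least fixed points of monotone operators *)

Lemma unit_valued_knaster_tarski (R : realType) (S : Type)
    (F : (S -> S -> R) -> S -> S -> R) :
  (forall d, unit_valued d -> unit_valued (F d)) ->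
  (forall d d', unit_valued d -> unit_valued d' ->
    (forall s t, d s t <= d' s t) -> forall s t, F d s t <= F d' s t) ->
  exists m, [/\ unit_valued m, F m = m &
    forall d, unit_valued d -> (forall s t, F d s t <= d s t) ->
      forall s t, m s t <= d s t].
Proof.
move=> Funit Fmono.
(* The least fixed point is the pointwise infimum [m] of the prefixed points; the constant 1 is one
   of them, so these infima are over nonempty sets. *)
pose P := [set d | unit_valued d /\ forall s t, F d s t <= d s t].
pose m s t := inf [set d s t | d in P].
have P1 : P (fun _ _ => 1).
  have u1 : unit_valued (fun _ _ : S => 1 : R) by move=> s t; rewrite ler01 lexx.
  by split=> // s t; case/andP: (Funit _ u1 s t).
have m_lb d s t : P d -> m s t <= d s t.
  move=> Pd; apply: ge_inf; last by exists d.
  by exists 0 => _ [d' [d'P _] <-]; case/andP: (d'P s t).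
have m_glb x s t : (forall d, P d -> x <= d s t) -> x <= m s t.
  move=> xP; apply: lb_le_inf; first by exists 1, (fun _ _ => 1).
  by move=> _ [d Pd <-]; exact: xP.
have mP : unit_valued m.
  move=> s t; rewrite (m_lb _ s t P1) andbT.
  by apply: m_glb => d [dP _]; case/andP: (dP s t).
have Fm_le s t : F m s t <= m s t.
  apply: m_glb => d Pd; have [dP Fd] := Pd.
  apply: le_trans (Fd s t); apply: Fmono => // u v; exact: m_lb.
exists m; split=> //; last by move=> d dP Fd s t; exact: m_lb.
(* Monotonicity applied to [F m <= m] makes [F m] itself a prefixed point, whence [m <= F m]. *)
apply/funext => s; apply/funext => t; apply/eqP; rewrite eq_le Fm_le/=.
by apply: m_lb; split; [exact: Funit|apply: Fmono => //; exact: Funit].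
Qed.

(** * Contraction of [Delta], its fixed point and the error bound *)

Section Contraction.
Context {R : realType} {L : metricType R} (M : ctmc R L) (lambda : R).
Hypothesis dL_le1 : forall x y : L, mdist x y <= 1.
Hypothesis lambda_gt0 : 0 < lambda.
Hypothesis lambda_lt1 : lambda < 1.

Implicit Types d : state M -> state M -> R.

Lemma state_inhabited : [set: state M] !=set0.
Proof. by have /card_gt0P[s _] := state_nonempty M; exists s. Qed.

(** [calT] is a convex combination of 1 and the Kantorovich distance, with weight [alpha] on 1. *)
Lemma calT_itv d s t : unit_valued d -> 0 <= calT M d s t <= 1.
Proof.
move=> dP; have d0 u v : 0 <= d u v by case/andP: (dP u v).
have K0 := kantorovich_ge0 (trans M s) (trans M t) d0.
have K1 := kantorovich_le1 (trans M s) (trans M t) dP.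
have /andP[? ?] := alpha_itv s t.
by rewrite /calT; apply/andP; split; nra.
Qed.

Lemma Delta_unit_valued d : unit_valued d -> unit_valued (Delta M lambda d).
Proof.
move=> dP s t; rewrite /Delta /beta.
case: insub => [s'|]; case: insub => [t'|]; rewrite ?ler01 ?lexx//.
  have /andP[T0 T1] := calT_itv s' t' dP.
  by rewrite le_max mdist_ge0/= ge_max dL_le1 mulr_ile1// ltW.
by rewrite mdist_ge0 dL_le1.
Qed.

Lemma Delta_le_add d d' (c : R) : 0 <= c ->
  (forall s t, 0 <= d s t) -> (forall s t, d s t <= d' s t + c) ->
  forall s t, Delta M lambda d s t <= Delta M lambda d' s t + lambda * c.
Proof.
move=> c0 d0 dd' s t; have lc0 : 0 <= lambda * c by rewrite mulr_ge0// ltW.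
rewrite /Delta; case: insub => [s'|]; case: insub => [t'|]; rewrite ?lerDl//.
have K := kantorovich_le_add (trans M s') (trans M t') d0 dd'.
have /andP[a0 a1] := alpha_itv s' t'.
(* The increment [c] is multiplied by [1 - alpha], which is at most 1. *)
have T : calT M d s' t' <= calT M d' s' t' + c by rewrite /calT; nra.
rewrite ge_max; apply/andP; split.
  by rewrite ler_wpDr// le_max lexx.
apply: (@le_trans _ _ (lambda * (calT M d' s' t' + c))).
  by rewrite ler_pM2l.
by rewrite mulrDr lerD2r le_max lexx orbT.
Qed.

Lemma Delta_contraction d d' : unit_valued d -> unit_valued d' ->
  sup_dist (Delta M lambda d) (Delta M lambda d') <= lambda * sup_dist d d'.
Proof.
move=> dP d'P; apply: sup_dist_le; first exact: state_inhabited.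
move=> s t; have e0 := sup_dist_ge0 state_inhabited dP d'P.
have d0 u v : 0 <= d u v by case/andP: (dP u v).
have d'0 u v : 0 <= d' u v by case/andP: (d'P u v).
have le1 u v := (le_add_sup_dist u v dP d'P).1.
have le2 u v := (le_add_sup_dist u v dP d'P).2.
have := Delta_le_add e0 d0 le1 s t; have := Delta_le_add e0 d'0 le2 s t.
by move=> ? ?; rewrite ler_norml; apply/andP; split; lra.
Qed.

Lemma iter_Delta_unit_valued n d :
  unit_valued d -> unit_valued (iter n (Delta M lambda) d).
Proof. by move=> dP; elim: n => //= n IHn; exact: Delta_unit_valued. Qed.

Lemma iter_Delta_contraction n d d' : unit_valued d -> unit_valued d' ->
  sup_dist (iter n (Delta M lambda) d) (iter n (Delta M lambda) d') <=
    lambda ^+ n * sup_dist d d'.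
Proof.
move=> dP d'P; elim: n => [|n IHn]; first by rewrite mul1r.
rewrite exprS -mulrA !iterS; apply: le_trans (Delta_contraction _ _) _.
1,2: exact: iter_Delta_unit_valued.
by rewrite ler_pM2l.
Qed.

Lemma fixpoint_unique d d' :
  fixpoint M lambda d -> fixpoint M lambda d' -> d = d'.
Proof.
move=> [dP dE] [d'P d'E]; apply: sup_dist_le0_eq => //.
have gap : 0 < 1 - lambda by rewrite subr_gt0.
(* For fixed points, contraction says that their distance [D] satisfies [D <= lambda * D], that is
   [(1 - lambda) * D <= 0]. *)
rewrite -(pmulr_rle0 _ gap) mulrBl mul1r subr_le0.
by have := Delta_contraction dP d'P; rewrite dE d'E.
Qed.

Lemma delta_least_fixpoint : least_fixpoint M lambda (delta M lambda).
Proof.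
have [|d d' dP d'P dd' s t|m [mP mE m_le]] :=
  @unit_valued_knaster_tarski R (state M) (Delta M lambda).
- exact: Delta_unit_valued.
(* Monotonicity is [Delta_le_add] at [c = 0]. *)
- rewrite -[leRHS]addr0 -(mulr0 lambda); apply: Delta_le_add => // u v.
    by case/andP: (dP u v).
  by rewrite addr0.
(* Existence ensures that the choice in [delta] returns a least fixed point and not the default
   value. *)
- apply: (@xgetPex _ _ (least_fixpoint M lambda)); exists m; split=> //.
  by move=> d [dP dE]; apply: m_le => // s t; rewrite dE.
Qed.

(** The triangle inequality through [Delta d] bounds the distance [e] from [d0] to [d] by
    [lambda * e] plus the distance from [Delta d] to [d]; solving for [e] gives the claim. *)
Lemma sup_dist_fixpoint_le d0 d : fixpoint M lambda d0 -> unit_valued d ->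
  sup_dist d0 d <= sup_dist (Delta M lambda d) d / (1 - lambda).
Proof.
move=> [d0P d0E] dP.
have tri := sup_dist_triangle state_inhabited d0P (Delta_unit_valued dP) dP.
have := Delta_contraction d0P dP; rewrite d0E => con.
by rewrite ler_pdivlMr ?subr_gt0//; lra.
Qed.

End Contraction.

Theorem theorem1p8 (R : realType) (L : metricType R)
    (L_nonempty : [set: L] !=set0)
    (dL_le1 : forall x y : L, mdist x y <= 1)
    (M : ctmc R L) (lambda : R) (lambda_gt0 : 0 < lambda)
    (lambda_lt1 : lambda < 1) :
  least_fixpoint M lambda (delta M lambda) /\
  (forall d, fixpoint M lambda d -> d = delta M lambda) /\
  (forall (n : nat) (d : state M -> state M -> R), unit_valued d ->
     sup_dist (delta M lambda) (iter n (Delta M lambda) d) <=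
       lambda ^+ n / (1 - lambda) * sup_dist (Delta M lambda d) d).
Proof.
have delta_lfp := delta_least_fixpoint M dL_le1 lambda_gt0 lambda_lt1.
have [delta_fp _] := delta_lfp; split=> //; split=> [d dP|n d dP].
  exact: fixpoint_unique dP delta_fp.
have [deltaP deltaE] := delta_fp.
have iter_delta : iter n (Delta M lambda) (delta M lambda) = delta M lambda.
  by elim: n => //= n ->.
(* Seeing [delta] as its own [n]-th iterate turns the error into a distance between two [n]-th
   iterates: contraction extracts [lambda ^+ n] and leaves the case [n = 0]. *)
rewrite -[X in sup_dist X _]iter_delta -mulrA.
apply: le_trans (iter_Delta_contraction _ _ _ _ _ _) _ => //.
rewrite ler_pM2l ?exprn_gt0// [leRHS]mulrC.
exact: sup_dist_fixpoint_le.
Qed.
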